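(* Let $\Omega=\{1,2,3,\dots\}$ be the set of all positive integers, $\mathcal{F}$ the $\sigma$-algebra of all subsets of $\Omega$, and $P$ the probability on $(\Omega,\mathcal{F})$ with $P(\{j\})=2^{-j}$ for all $j\in\Omega$. Let $E=L^0=L^0(\mathcal{F},\mathbb{R})$, regarded as a module over itself, and let $M=\mathrm{span}_{L^0}\{\tilde I_{\{j\}}:j\in\Omega\}$. For $\varepsilon\in L^0_{++}$ let $B_\varepsilon=\{x\in E:|x|\leqslant\varepsilon\}$ and $U_\varepsilon=M+B_\varepsilon$. Then every $U_\varepsilon$ is $L^0$-convex, $L^0$-absorbent and $L^0$-balanced, the family $\mathcal{U}=\{U_\varepsilon:\varepsilon\in L^0_{++}\}$ is a neighborhood base of $0$ of a locally $L^0$-convex topology $\mathcal{T}$ on $E$, namely $$\mathcal{T}=\{V\subset E:\text{for every }y\in V\text{ there is }\varepsilon\in L^0_{++}\text{ with }y+U_\varepsilon\subset V\},$$ and the topology $\mathcal{T}$ cannot be induced by any family of $L^0$-seminorms on $E$.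
   Context: Here the scalar field is $K=\mathbb{R}$. $L^0=L^0(\mathcal{F},\mathbb{R})$ is the algebra of equivalence classes (modulo $P$-almost sure equality) of real-valued $\mathcal{F}$-measurable random variables on $\Omega$, partially ordered by $\xi\leqslant\eta$ iff $\xi\le\eta$ $P$-almost surely. $L^0_+=\{\xi\in L^0:\xi\geqslant 0\}$ and $L^0_{++}=\{\xi\in L^0:\xi>0\ P\text{-a.s. on }\Omega\}$. $|\xi|$ is the class of the pointwise absolute value. $\tilde I_A$ is the equivalence class of the characteristic function of $A\in\mathcal{F}$. For a subset $C$ of an $L^0$-module $E$, $\mathrm{span}_{L^0}(C)=\{\sum_{i=1}^n x_ic_i: c_i\in C,\ x_i\in L^0,\ 1\le i\le n,\ n\in\mathbb{N}\}$ is the $L^0$-submodule generated by $C$. The topology $\mathcal{T}_c$ on $L^0$ consists of all $V\subset L^0$ such that for every $y\in V$ there is $\varepsilon\in L^0_{++}$ with $y+\{\xi\in L^0:|\xi|\leqslant\varepsilon\}\subset V$. A topological $L^0$-module $(E,\mathcal{T})$ is an $L^0$-module $E$ with a topology $\mathcal{T}$ such that addition $(E,\mathcal{T})\times(E,\mathcal{T})\to(E,\mathcal{T})$ and module multiplication $(L^0,\mathcal{T}_c)\times(E,\mathcal{T})\to(E,\mathcal{T})$ are continuous for the product topologies. A subset $U\subset E$ is: $L^0$-convex if $\xi x_1+(1-\xi)x_2\in U$ for all $x_1,x_2\in U$ and $\xi\in L^0$ with $0\leqslant\xi\leqslant1$; $L^0$-absorbent if for every $x\in E$ there is $\xi\in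 L^0_{++}$ with $x\in\xi U$; $L^0$-balanced if $\xi x\in U$ for all $x\in U$ and $\xi\in L^0$ with $|\xi|\leqslant1$. The topology $\mathcal{T}$ of a topological $L^0$-module $(E,\mathcal{T})$ is locally $L^0$-convex if $0\in E$ has a neighborhood base consisting of $L^0$-convex, $L^0$-absorbent and $L^0$-balanced sets. An $L^0$-seminorm on $E$ is a function $\|\cdot\|:E\to L^0_+$ with $\|\xi x\|=|\xi|\,\|x\|$ for all $\xi\in L^0$, $x\in E$, and $\|x_1+x_2\|\leqslant\|x_1\|+\|x_2\|$ for all $x_1,x_2\in E$. For a family $\mathcal{P}$ of $L^0$-seminorms on $E$, a finite $\mathcal{Q}\subset\mathcal{P}$ and $\varepsilon\in L^0_{++}$, let $U_{\mathcal{Q},\varepsilon}=\{x\in E:\|x\|\leqslant\varepsilon\ \text{for all }\|\cdot\|\in\mathcal{Q}\}$. The topology induced by $\mathcal{P}$ is the (translation-invariant) topology on $E$ for which $\{U_{\mathcal{Q},\varepsilon}:\mathcal{Q}\subset\mathcal{P}\text{ finite},\ \varepsilon\in L^0_{++}\}$ is a neighborhood base of $0$, i.e. $V\subset E$ is open iff for every $y\in V$ there are such $\mathcal{Q},\varepsilon$ with $y+U_{\mathcal{Q},\varepsilon}\subset V$. *)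

(* Defs.v *)
From HB Require Import structures.
From mathcomp Require Import all_boot all_order all_algebra generic_quotient.
From mathcomp Require Import all_classical all_reals all_analysis.
From mathcomp Require Import measurable_realfun.

Set Implicit Arguments.
Unset Strict Implicit.
Unset Printing Implicit Defensive.
Import Order.TTheory GRing.Theory Num.Theory.
Import numFieldNormedType.Exports.

Local Open Scope classical_set_scope.
Local Open Scope ring_scope.

Section L0_ring.
Context d (T : measurableType d) (R : realType) (P : probability T R).
Local Open Scope quotient_scope.

Definition L0 : Type := {mfun_ P, T >-> R}.
HB.instance Definition _ := Choice.on L0.
HB.instance Definition _ := EqQuotient.on L0.

Implicit Types (f g h : {mfun T >-> R}) (x y z : L0).

Lemma L0_eqP f g : \pi_L0 f = \pi_L0 g <-> \forall w \ae P, f w = g w.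
Proof.
split=> [/eqmodP/asboolP|H]; first by apply: filterS => w; exact.
by apply/eqmodP/asboolP; apply: filterS H.
Qed.

Lemma repr_ae f : \forall w \ae P, repr (\pi_L0 f) w = f w.
Proof. by apply/L0_eqP; rewrite reprK. Qed.

Definition L0_zero : L0 := \pi_L0 (0 : {mfun T >-> R}).
Definition L0_one : L0 := \pi_L0 (1 : {mfun T >-> R}).
Definition L0_opp x : L0 := \pi_L0 (- (repr x : {mfun T >-> R})).
Definition L0_add x y : L0 := \pi_L0 ((repr x : {mfun T >-> R}) + repr y).
Definition L0_mul x y : L0 := \pi_L0 ((repr x : {mfun T >-> R}) * repr y).

Fact L0_addE x y : \forall w \ae P, repr (L0_add x y) w = repr x w + repr y w.
Proof. exact: repr_ae. Qed.
Fact L0_mulE x y : \forall w \ae P, repr (L0_mul x y) w = repr x w * repr y w.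
Proof. exact: repr_ae. Qed.

Fact L0_ext x y : (\forall w \ae P, repr x w = repr y w) -> x = y.
Proof. by move=> xy; rewrite -[x]reprK -[y]reprK; apply/L0_eqP. Qed.

Fact L0_addA : associative L0_add.
Proof.
move=> x y z; apply/L0_eqP; apply: filterS2 (L0_addE y z) (L0_addE x y) => w.
by rewrite !mfunD /= => -> ->; exact: addrA.
Qed.
Fact L0_addC : commutative L0_add.
Proof. by move=> x y; rewrite /L0_add addrC. Qed.
Fact L0_add0 : left_id L0_zero L0_add.
Proof.
move=> x; apply: L0_ext.
by apply: filterS2 (L0_addE L0_zero x) (repr_ae 0) => w -> ->; exact: add0r.
Qed.
Fact L0_addN : left_inverse L0_zero L0_opp L0_add.
Proof.
move=> x; apply/L0_eqP.
by apply: filterS (repr_ae (- (repr x : {mfun T >-> R}))) => w;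
  rewrite mfunD /= => ->; exact: addNr.
Qed.
HB.instance Definition _ :=
  GRing.isZmodule.Build L0 L0_addA L0_addC L0_add0 L0_addN.

Fact L0_mulA : associative L0_mul.
Proof.
move=> x y z; apply/L0_eqP; apply: filterS2 (L0_mulE y z) (L0_mulE x y) => w.
by rewrite !mfunM /= => -> ->; exact: mulrA.
Qed.
Fact L0_mulC : commutative L0_mul.
Proof. by move=> x y; rewrite /L0_mul mulrC. Qed.
Fact L0_mul1 : left_id L0_one L0_mul.
Proof.
move=> x; apply: L0_ext.
by apply: filterS2 (L0_mulE L0_one x) (repr_ae 1) => w -> ->; exact: mul1r.
Qed.
Fact L0_mulDl : left_distributive L0_mul L0_add.
Proof.
move=> x y z; apply: L0_ext.
apply: filterS2 (L0_mulE (L0_add x y) z) (filterI (L0_addE x y)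
  (filterI (L0_addE (L0_mul x z) (L0_mul y z))
    (filterI (L0_mulE x z) (L0_mulE y z)))) => w.
by move=> -> [-> [-> [-> ->]]]; exact: mulrDl.
Qed.
HB.instance Definition _ := GRing.Zmodule_isComPzRing.Build L0
  L0_mulA L0_mulC L0_mul1 L0_mulDl.

Definition L0_le x y : bool := `[< \forall w \ae P, repr x w <= repr y w >].
Fact L0_le_refl : reflexive L0_le.
Proof. by move=> x; apply/asboolP; exact: aeW. Qed.
Fact L0_le_anti : antisymmetric L0_le.
Proof.
move=> x y /andP[/asboolP xy /asboolP yx]; rewrite -[x]reprK -[y]reprK.
by apply/L0_eqP; apply: filterS2 xy yx => w wx wy; apply/le_anti/andP.
Qed.
Fact L0_le_trans : transitive L0_le.
Proof.
move=> y x z /asboolP xy /asboolP yz; apply/asboolP.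
by apply: filterS2 xy yz => w; exact: le_trans.
Qed.
(* Only [<=] is the intended relation: the induced strict order [x < y] means
   [x <= y] and [x != y], not almost sure strict inequality. *)
HB.instance Definition _ := Order.Le_isPOrder.Build orderedzmod.ring_display L0
  L0_le_refl L0_le_anti L0_le_trans.

(* L^0_{++} *)
Definition L0pp : set L0 := [set x : L0 | \forall w \ae P, 0 < repr x w].

Definition L0_abs x : L0 :=
  \pi_L0 ((@Num.norm R R) \o repr x).

Definition L0_indic (A : set T) (mA : measurable A) : L0 :=
  \pi_L0 (indic_mfun A mA).

End L0_ring.
Arguments L0pp {d T R P} _.

Record is_topology (T : Type) (op : set_system T) : Prop := IsTopology {
  topology_setT : op setT ;
  topology_setI : setI_closed op ;
  topology_bigU : forall (I : Type) (f : I -> set T),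
    (forall i, op (f i)) -> op (\bigcup_i f i)
}.

Definition with_topology (A : pzRingType) (E : lmodType A) (op : set_system E)
  (op_top : is_topology op) : Type := E.

Section with_topology.
Context (A : pzRingType) (E : lmodType A) (op : set_system E).
Context (op_top : is_topology op).
HB.instance Definition _ := GRing.Lmodule.on (with_topology op_top).
HB.instance Definition _ := isOpenTopological.Build (with_topology op_top)
  (topology_setT op_top) (topology_setI op_top) (topology_bigU op_top).
End with_topology.

Definition nbhs_base (T : topologicalType) (x : T) (B : set_system T) :=
  B `<=` nbhs x /\ forall N, nbhs x N -> exists2 U, B U & U `<=` N.

(* The translation-invariant topology for which [B] is meant to be a
   neighborhood base of 0; it is defined for an arbitrary family [B]. *)
Definition invariant_topology (E : zmodType) (B : set_system E) : set_system E :=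
  [set V | forall y, V y -> exists2 U, B U & [set y + u | u in U] `<=` V].

Lemma invariant_topologyP (E : zmodType) (B : set_system E) :
  B !=set0 ->
  (forall U V, B U -> B V -> exists2 W, B W & W `<=` U `&` V) ->
  is_topology (invariant_topology B).
Proof.
move=> [U0 BU0] BI; split.
- by move=> y _; exists U0.
- move=> V W oV oW y [/oV[U1 BU1 yU1] /oW[U2 BU2 yU2]].
  have [U BU UI] := BI _ _ BU1 BU2; exists U => // _ [u /UI[u1 u2] <-].
  by split; [apply: yU1; exists u | apply: yU2; exists u].
- move=> I f of_ y [i _ /of_[U BU yU]]; exists U => //.
  by move=> z /yU fz; exists i.
Qed.

Definition lspan (A : pzRingType) (E : lmodType A) (C : set E) : set E :=
  [set x | exists n (a : 'I_n -> A) (c : 'I_n -> E),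
    (forall i, C (c i)) /\ x = \sum_(i < n) a i *: c i].

Section L0_modules.
Context d (T : measurableType d) (R : realType) (P : probability T R).

Definition L0_ball (eps : L0 P) : set (L0 P) := [set x | L0_abs x <= eps].

(* T_c *)
Definition L0_Tc : set_system (L0 P) :=
  invariant_topology [set L0_ball eps | eps in L0pp].

Lemma L0_Tc_topology : is_topology L0_Tc.
Proof.
apply: invariant_topologyP.
  exists (L0_ball 1), 1 => //.
  by apply: filterS (repr_ae P 1) => w /= ->; exact: ltr01.
move=> _ _ [e ppe <-] [f ppf <-].
pose g : L0 P := (\pi_(L0 P) (min_mfun (repr e) (repr f)))%qT.
have gE := repr_ae P (min_mfun (repr e) (repr f)).
exists (L0_ball g).
  exists g => //; apply: filterS2 gE (filterI ppe ppf) => w /= -> [ew fw].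
  by rewrite lt_min ew fw.
move=> x /= xg; split; apply: le_trans xg _; apply/asboolP;
  by apply: filterS gE => w /= ->; rewrite ge_min lexx ?orbT.
Qed.

Definition L0c := @with_topology (L0 P) (L0 P)^o L0_Tc L0_Tc_topology.
HB.instance Definition _ := Topological.on L0c.

Context (E : lmodType (L0 P)).
Implicit Types (U : set E) (op : set_system E).

Definition L0_convex U := forall x1 x2 (xi : L0 P),
  U x1 -> U x2 -> 0 <= xi -> xi <= 1 -> U (xi *: x1 + (1 - xi) *: x2).

Definition L0_absorbent U := forall x : E,
  exists2 xi : L0 P, L0pp xi & [set xi *: u | u in U] x.

Definition L0_balanced U := forall x (xi : L0 P),
  U x -> L0_abs xi <= 1 -> U (xi *: x).

Definition topological_L0_module op (op_top : is_topology op) :=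
  let ET := with_topology op_top in
  continuous (fun xy : ET * ET => xy.1 + xy.2) /\
  continuous (fun ax : L0c * ET => (ax.1 : L0 P) *: ax.2).

Definition locally_L0_convex op (op_top : is_topology op) :=
  topological_L0_module op_top /\
  exists B : set_system E, nbhs_base (0 : with_topology op_top) B /\
    forall U, B U -> [/\ L0_convex U, L0_absorbent U & L0_balanced U].

Definition L0_seminorm (p : E -> L0 P) :=
  [/\ forall x, 0 <= p x,
      forall (xi : L0 P) x, p (xi *: x) = L0_abs xi * p x &
      forall x y, p (x + y) <= p x + p y].

Definition seminorm_ball (Q : set (E -> L0 P)) (eps : L0 P) : set E :=
  [set x | forall p, Q p -> p x <= eps].

Definition seminorm_topology (Ps : set (E -> L0 P)) : set_system E :=
  invariant_topology [set U | exists Q eps,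
    [/\ finite_set Q, Q `<=` Ps, L0pp eps & U = seminorm_ball Q eps]].

End L0_modules.

(* The positive integers, with all subsets measurable. *)
Definition posint : Type := {n : nat | (0 < n)%N}.
HB.instance Definition _ := Choice.on posint.
HB.instance Definition _ := isPointed.Build posint (exist _ 1%N isT).
HB.instance Definition _ := @isMeasurable.Build default_measure_display posint
  discrete_measurable discrete_measurable0
  discrete_measurableC discrete_measurableU.

Lemma measurable_posint (A : set posint) : measurable A.
Proof. by []. Qed.

Section dyadic.
Context (R : realType).
Let m (k : nat) : {measure set posint -> \bar R} :=
  mscale (2^-1 ^+ k.+1)%:nng (@dirac _ _ (exist _ k.+1 isT : posint) R).
Definition dyadic := mseries m 0.
HB.instance Definition _ := Measure.on dyadic.
Lemma dyadic_setT : dyadic setT = 1%E.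
Proof.
rewrite /dyadic /mseries (eq_eseriesr (g := fun k => (2^-1 ^+ k.+1)%:E)); last first.
  by move=> k _; rewrite /m /= /mscale /= diracT mule1.
apply/cvg_lim => //.
rewrite (_ : (fun n => _) = EFin \o series (geometric 2^-1 2^-1)); last first.
  apply/funext => n /=; rewrite sumEFin /series /=; congr EFin.
  by apply: eq_bigr => i _; rewrite exprS.
apply: cvg_EFin; first by near=> n.
have e : (1 - 2^-1 : R) = 2^-1 by rewrite [X in X - _](splitr 1) mul1r addrK.
have h : `|2^-1 : R| < 1 by rewrite ger0_norm ?invr_ge0 // invf_lt1 // ltr1n.
have := @cvg_geometric_series R 2^-1 2^-1 h.
rewrite e mulfV //.
Unshelve. all: by end_near. Qed.
HB.instance Definition _ := Measure_isProbability.Build _ _ _ dyadic dyadic_setT.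
Lemma dyadicE (j : posint) : dyadic [set j] = (2 ^- val j)%:E.
Proof.
case: j => -[//|k] jp; rewrite (_ : exist _ _ _ = (exist _ k.+1 isT : posint)); last exact: val_inj.
rewrite /dyadic /mseries (@nneseriesD1 _ _ k) //.
rewrite /= /mscale /= diracE mem_set // mule1 eseries0 ?adde0 ?exprVn// => i _ /= ik.
rewrite /m /= /mscale /= diracE memNset ?mule0 //= => -[] [] h.
by rewrite h eqxx in ik.
Qed.
Lemma dyadic_probability_exists :
  exists P : probability posint R, forall j : posint, P [set j] = (2 ^- val j)%:E.
Proof. exists (HB.pack dyadic : probability _ _). exact: dyadicE. Qed.
End dyadic.

Section counterexample.
Context (R : realType) (P : probability posint R).

Definition indic_span : set (L0 P)^o :=
  @lspan (L0 P) (L0 P)^o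
    [set L0_indic P (measurable_posint [set j]) | j in [set: posint]].

Definition span_ball (eps : L0 P) : set (L0 P)^o :=
  [set m + b | m in indic_span & b in L0_ball eps].

Definition span_topology : set_system (L0 P)^o :=
  invariant_topology [set span_ball eps | eps in L0pp].

End counterexample.
Arguments indic_span {R} P _.
Arguments span_topology {R} P _.

(* Main.v *)
Require Import Defs.
From HB Require Import structures.
From mathcomp Require Import all_boot all_order all_algebra.
From mathcomp Require Import all_classical all_reals all_analysis.
From mathcomp Require Import ring lra.
Import Order.TTheory GRing.Theory Num.Theory.
Local Open Scope classical_set_scope.
Local Open Scope ring_scope.

(** Singletons are not negligible, so almost sure relations hold everywhere and
    L0 is the ring of all real functions on the positive integers, with its
    pointwise structure ([coord]).  The module generated by the indicators of
    singletons consists of the functions of finite support ([indic_spanP]), and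
    [span_ball e] of the functions x such that |x j| <= e j for all but finitely
    many j ([span_ballP]).

    In this description, convexity, absorbency and balancedness are checked
    coordinatewise.  The continuity of the module operations follows from the
    halving property [span_ball_half] and, for scalar multiplication, from
    b y - a x = (b - a) x + b (y - x).

    No family of seminorms induces the topology.  Let p be a seminorm for which
    {p < 1} is open.  This set then contains the indicator span, and p vanishes
    on it because the span is closed under scalars.  But a seminorm is local:
    the j-th coordinate of p x is that of p applied to x cut off to {j}, and
    this cutoff has finite support.  So p = 0 ([span_open_seminorm0]), and the
    only topology that seminorms of this kind can induce is the trivial one.
    The set of functions that are bounded outside a finite set is however open,
    and it is neither empty nor the whole space. *)

(** * Neighborhoods in a translation-invariant topology *)

Section InvariantTopology.
Context (A : pzRingType) (E : lmodType A) (B : set_system E).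
Hypothesis B_top : is_topology (invariant_topology B).
Hypothesis B_zero : forall U, B U -> U 0.
Hypothesis B_half : forall U, B U ->
  exists2 V, B V & forall u v, V u -> V v -> U (u + v).

(** The halving property makes the set of points around which some translated
    basic set stays in N open: it serves as the interior of N. *)
Lemma nbhs_invariantP (x : with_topology B_top) (N : set E) :
  nbhs x N <-> exists2 U, B U & forall u, U u -> N (x + u).
Proof.
split=> [|[U BU UN]].
  rewrite nbhsE => -[V [oV Vx] VN]; have [U BU UV] := oV _ Vx.
  by exists U => // u Uu; apply: VN; apply: UV; exists u.
rewrite nbhsE.
exists [set y : with_topology B_top | exists2 V, B V & forall u, V u -> N (y + u)]; last first.
  by move=> y [V BV VN]; rewrite -[y]addr0; apply: VN; exact: B_zero.
split; last by exists U.
move=> y [V BV VN]; have [W BW WV] := B_half _ BV; exists W => // _ [w Ww <-].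
by exists W => // u Wu; rewrite -addrA; apply: VN; exact: WV.
Qed.

End InvariantTopology.

(** * Coordinates *)

(** The estimate behind the continuity of scalar multiplication at (a, x).  The
    bound 1 on |b - a| gives |b| <= |a| + 1, which controls b (y - x). *)
Lemma scale_bound (R : realFieldType) (a b x y h : R) : 0 <= h ->
  `|b - a| <= Num.min 1 (h / (`|x| + 1)) -> `|y - x| <= h / (`|a| + 1) ->
  `|b * y - a * x| <= h + h.
Proof.
move=> h0; rewrite le_min => /andP[ba1 bax] yx.
have -> : b * y - a * x = (b - a) * x + b * (y - x) by ring.
rewrite (le_trans (ler_normD _ _))// !normrM lerD//.
  rewrite (le_trans (ler_wpM2r (normr_ge0 _) bax))// mulrAC.
  by rewrite ler_pdivrMr ?ltr_wpDl// ler_wpM2l// lerDl.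
have ba : `|b| <= `|a| + 1.
  by rewrite -[b](subrK a) addrC (le_trans (ler_normD _ _))// lerD2l.
rewrite (le_trans (ler_wpM2l (normr_ge0 _) yx))// mulrCA mulrA.
by rewrite ler_pdivrMr ?ltr_wpDl// ler_wpM2l.
Qed.

Section Coordinates.
Set Implicit Arguments.
Unset Strict Implicit.
Context (R : realType) (P : probability posint R).
Hypothesis P_single : forall j : posint, P [set j] = ((2 ^- val j)%:E)%E.
Implicit Types (x y e : L0 P) (f : posint -> R) (j : posint).

Definition coord x j : R := repr x j.

(** The only place where the weights of the singletons matter: they are
    positive. *)
Lemma ae_everywhere (Q : posint -> Prop) :
  (\forall w \ae P, Q w) <-> forall w, Q w.
Proof.
split=> [[A [mA PA0 QA]] w|]; last exact: aeW.
apply: contrapT => nQw.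
have : (P [set w] <= P A)%E.
  apply: le_measure; rewrite ?inE //.
  by move=> _ ->; exact: QA.
by rewrite PA0 P_single lee_fin leNgt invr_gt0 exprn_gt0.
Qed.

Lemma measurable_posint_fun f : measurable_fun setT f.
Proof. by move=> _ Y _; exact: measurable_posint. Qed.

Definition of_coord f : L0 P :=
  (\pi_(L0 P) (mfun_Sub (mem_set (measurable_posint_fun f))))%qT.

Lemma coord_pi (f : {mfun posint >-> R}) j : coord (\pi_(L0 P) f)%qT j = f j.
Proof. by move: j; apply/ae_everywhere; exact: repr_ae. Qed.

Lemma coordK f j : coord (of_coord f) j = f j.
Proof. by rewrite coord_pi. Qed.

Lemma coord_inj x y : (forall j, coord x j = coord y j) -> x = y.
Proof. by move=> xy; apply: L0_ext; exact: aeW. Qed.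

Lemma coord0 j : coord 0 j = 0.
Proof. by rewrite coord_pi. Qed.

Lemma coord1 j : coord 1 j = 1.
Proof. by rewrite coord_pi. Qed.

Lemma coordD x y j : coord (x + y) j = coord x j + coord y j.
Proof. by rewrite coord_pi. Qed.

Lemma coordN x j : coord (- x) j = - coord x j.
Proof. by rewrite coord_pi. Qed.

Lemma coordM x y j : coord (x * y) j = coord x j * coord y j.
Proof. by rewrite coord_pi. Qed.

Lemma coord_abs x j : coord (L0_abs x) j = `|coord x j|.
Proof. by rewrite coord_pi. Qed.

Lemma coord_indic i j :
  coord (L0_indic P (measurable_posint [set i])) j = (j == i)%:R.
Proof. by rewrite coord_pi /= /measurable_realfun.mindic indicE in_set1. Qed.

Lemma le_coordP x y : x <= y <-> forall j, coord x j <= coord y j.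
Proof.
by split=> [/asboolP/ae_everywhere|h]; last by apply/asboolP/ae_everywhere.
Qed.

Lemma L0ppP e : L0pp e <-> forall j, 0 < coord e j.
Proof. exact: ae_everywhere. Qed.

(** * Conditions on all but finitely many coordinates *)

Definition for_large (Q : posint -> Prop) : Prop :=
  exists n, forall j, (n < val j)%N -> Q j.

Lemma for_large_all (Q : posint -> Prop) : (forall j, Q j) -> for_large Q.
Proof. by move=> hQ; exists 0%N. Qed.

Lemma for_large_imp (Q1 Q2 : posint -> Prop) :
  (forall j, Q1 j -> Q2 j) -> for_large Q1 -> for_large Q2.
Proof. by move=> h [n Q1n]; exists n => j /Q1n/h. Qed.

Lemma for_large_imp2 (Q1 Q2 Q3 : posint -> Prop) :
  (forall j, Q1 j -> Q2 j -> Q3 j) ->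
  for_large Q1 -> for_large Q2 -> for_large Q3.
Proof.
move=> h [n Qn] [m Qm]; exists (maxn n m) => j.
by rewrite gtn_max => /andP[/Qn q1 /Qm]; exact: h.
Qed.

Lemma indic_spanP x : indic_span P x <-> for_large (fun j => coord x j = 0).
Proof.
split=> [[n [a [c [hc ->]]]]|[n x0]].
  apply: (big_ind (fun z : L0 P => for_large (fun j => coord z j = 0))).
  - by apply: for_large_all; exact: coord0.
  - by move=> y z; apply: for_large_imp2 => j yj zj; rewrite coordD yj zj addr0.
  - move=> i _; have [k _ <-] := hc i; exists (val k) => j kj.
    rewrite coordM coord_indic (_ : (j == k) = false) ?mulr0//.
    by apply/eqP => jk; rewrite jk ltnn in kj.
(* A function supported in {1, ..., n} is the sum of x times the indicator of
   {i + 1}, over i < n. *)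
exists n, (fun=> x),
  (fun i => L0_indic P (measurable_posint [set (exist _ i.+1 isT : posint)])).
split=> [i|]; first by exists (exist _ i.+1 isT).
apply: coord_inj => j.
rewrite (big_morph (fun z => coord z j) (fun y z => coordD y z j) (coord0 j)).
under eq_bigr do rewrite coordM coord_indic.
have [jn|nj] := leqP (val j) n; last by rewrite big1 ?x0// => i _; rewrite mul0r.
case: j jn => -[//|k] kP /= kn.
rewrite (bigD1 (Ordinal kn))//= big1 => [|i ik].
  by rewrite addr0 -val_eqE eqxx mulr1.
rewrite -val_eqE /= eqSS (_ : (k == i) = false) ?mulr0//.
by apply/eqP => ki; move/eqP: ik; apply; exact: val_inj.
Qed.

Lemma L0_ballP e x : L0_ball e x <-> forall j, `|coord x j| <= coord e j.
Proof.
split=> [/le_coordP h j|h]; first by rewrite -coord_abs.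
by apply/le_coordP => j; rewrite coord_abs.
Qed.

(** Conversely, the finitely many coordinates that violate the bound form an
    element of the span, and the others an element of the ball; positivity of
    [e] bounds the zeros put in place of the violating coordinates. *)
Lemma span_ballP e x : L0pp e ->
  span_ball e x <-> for_large (fun j => `|coord x j| <= coord e j).
Proof.
move=> /L0ppP e0; split=> [[m /indic_spanP m0 [b /L0_ballP be <-]]|xe].
  by apply: for_large_imp m0 => j m0; rewrite coordD m0 add0r.
exists (of_coord (fun j => if `|coord x j| <= coord e j then 0 else coord x j)).
  by apply/indic_spanP; apply: for_large_imp xe => j xj; rewrite coordK xj.
exists (of_coord (fun j => if `|coord x j| <= coord e j then coord x j else 0)).
  apply/L0_ballP => j; rewrite coordK; case: ifP => // _.
  by rewrite normr0 ltW.
by apply: coord_inj => j; rewrite coordD !coordK; case: ifP; rewrite ?add0r ?addr0.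
Qed.

(** * The locally convex topology *)

Lemma span_ball_convex e : L0pp e -> L0_convex (span_ball e : set (L0 P)^o).
Proof.
move=> e0 x1 x2 xi /(span_ballP _ e0) h1 /(span_ballP _ e0) h2.
move=> /le_coordP xi0 /le_coordP xi1; apply/(span_ballP _ e0).
apply: for_large_imp2 h1 h2 => j h1 h2.
have := xi0 j; have := xi1 j; rewrite coord0 coord1 => le1 ge0.
rewrite coordD !coordM coordD coordN coord1 (le_trans (ler_normD _ _))//.
have ge0' : 0 <= 1 - coord xi j by rewrite subr_ge0.
rewrite !normrM (ger0_norm ge0) (ger0_norm ge0').
by have := ler_wpM2l ge0 h1; have := ler_wpM2l ge0' h2; lra.
Qed.

Lemma span_ball_absorbent e : L0pp e -> L0_absorbent (span_ball e : set (L0 P)^o).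
Proof.
move=> e0 x; have /L0ppP e0' := e0.
have xi0 j : 0 < `|coord x j| / coord e j + 1.
  by rewrite ltr_wpDl// divr_ge0// ltW.
exists (of_coord (fun j => `|coord x j| / coord e j + 1)).
  by apply/L0ppP => j; rewrite coordK.
exists (of_coord (fun j => (`|coord x j| / coord e j + 1)^-1 * coord x j)).
  apply/(span_ballP _ e0); apply: for_large_all => j; rewrite coordK normrM.
  rewrite gtr0_norm ?invr_gt0// mulrC ler_pdivrMr// mulrDr mulr1 mulrCA.
  by rewrite mulfV ?gt_eqF// mulr1 lerDl ltW.
by apply: coord_inj => j; rewrite coordM !coordK mulVKf ?gt_eqF.
Qed.

Lemma span_ball_balanced e : L0pp e -> L0_balanced (span_ball e : set (L0 P)^o).
Proof.
move=> e0 x xi /(span_ballP _ e0) xe /le_coordP xi1; apply/(span_ballP _ e0).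
apply: for_large_imp xe => j xj; rewrite coordM normrM.
have := xi1 j; rewrite coord_abs coord1 => xij.
by rewrite (le_trans _ xj)// ler_piMl.
Qed.

Lemma span_ball0 e : L0pp e -> span_ball e 0.
Proof.
move=> e0; apply/(span_ballP _ e0); apply: for_large_all => j.
by rewrite coord0 normr0 ltW//; move: j; apply/L0ppP.
Qed.

Definition half e : L0 P := of_coord (fun j => coord e j / 2).

Lemma half_pp e : L0pp e -> L0pp (half e).
Proof. by move=> /L0ppP e0; apply/L0ppP => j; rewrite coordK divr_gt0. Qed.

Lemma half_bound e j (a b : R) : a <= coord (half e) j -> b <= coord (half e) j ->
  a + b <= coord e j.
Proof. by rewrite coordK => ha hb; lra. Qed.

Lemma span_ball_half e u v : L0pp e ->
  span_ball (half e) u -> span_ball (half e) v -> span_ball e (u + v).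
Proof.
move=> e0 /(span_ballP _ (half_pp e0)) hu /(span_ballP _ (half_pp e0)) hv.
apply/(span_ballP _ e0); apply: for_large_imp2 hu hv => j uj vj.
by rewrite coordD (le_trans (ler_normD _ _))//; exact: half_bound.
Qed.

Lemma L0_ball_half e u v :
  L0_ball (half e) u -> L0_ball (half e) v -> L0_ball e (u + v).
Proof.
move=> /L0_ballP hu /L0_ballP hv; apply/L0_ballP => j.
by rewrite coordD (le_trans (ler_normD _ _))//; exact: half_bound.
Qed.

Lemma span_ball_le e e' : L0pp e -> L0pp e' -> e <= e' ->
  span_ball e `<=` span_ball e'.
Proof.
move=> e0 e0' /le_coordP ee' x /(span_ballP _ e0) xe; apply/(span_ballP _ e0').
by apply: for_large_imp xe => j xj; exact: le_trans xj (ee' j).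
Qed.

Lemma span_topologyP : is_topology (span_topology P).
Proof.
apply: invariant_topologyP.
  by exists (span_ball 1), 1 => //; apply/L0ppP => j; rewrite coord1.
move=> _ _ [e e0 <-] [f f0 <-].
have /L0ppP e0' := e0; have /L0ppP f0' := f0.
have g0 : L0pp (of_coord (fun j => Num.min (coord e j) (coord f j))).
  by apply/L0ppP => j; rewrite coordK lt_min e0' f0'.
eexists; first by exists (of_coord (fun j => Num.min (coord e j) (coord f j))).
by move=> x xg; split; apply: span_ball_le xg => //; apply/le_coordP => j;
  rewrite coordK ge_min lexx ?orbT.
Qed.

Lemma nbhs_spanP (x : with_topology span_topologyP) (N : set (L0 P)^o) :
  nbhs x N <->
  exists2 e, L0pp e & forall u : (L0 P)^o, span_ball e u -> N (x + u).
Proof.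
pose B : set_system (L0 P)^o := [set span_ball eps | eps in L0pp].
have B0 U : B U -> U 0.
  by move=> [e e0 <-]; exact: span_ball0.
have Bhalf U : B U -> exists2 V, B V & forall u v, V u -> V v -> U (u + v).
  move=> [e e0 <-]; exists (span_ball (half e)).
    by exists (half e) => //; exact: half_pp.
  by move=> u v; exact: span_ball_half.
apply: iff_trans (nbhs_invariantP _ _ _ span_topologyP B0 Bhalf x N) _.
split=> [[_ [e e0 <-] eN]|[e e0 eN]]; first by exists e.
by exists (span_ball e) => //; exists e.
Qed.

Lemma nbhs_L0c (a : L0c P) e : L0pp e ->
  nbhs a [set b : L0c P | L0_ball e (b - a : L0 P)].
Proof.
move=> e0; apply/nbhs_invariantP.
- move=> _ [f /L0ppP f0 <-]; apply/L0_ballP => j.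
  by rewrite coord0 normr0 ltW.
- move=> _ [f f0 <-]; exists (L0_ball (half f)).
    by exists (half f) => //; exact: half_pp.
  by move=> u v; exact: L0_ball_half.
- exists (L0_ball e); first by exists e.
  by move=> u ue /=; rewrite addrAC subrr add0r.
Qed.

Lemma span_topology_module : topological_L0_module span_topologyP.
Proof.
split=> -[x y] N /nbhs_spanP[e e0 eN].
  exists ([set x' : with_topology span_topologyP | span_ball (half e) (x' - x)],
          [set y' : with_topology span_topologyP | span_ball (half e) (y' - y)]).
    by split; apply/nbhs_spanP; exists (half e); try exact: half_pp;
      move=> u ue /=; rewrite addrAC subrr add0r.
  move=> [x' y'] /= [hx hy].
  have := eN _ (span_ball_half e0 hx hy).
  by rewrite addrACA !(addrC _ (_ - _)) !subrK.
rename x into a, y into x.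
pose d : L0 P :=
  of_coord (fun j => Num.min 1 (coord (half e) j / (`|coord x j| + 1))).
pose f : L0 P := of_coord (fun j => coord (half e) j / (`|coord a j| + 1)).
have /L0ppP h0 := half_pp e0.
have d0 : L0pp d.
  by apply/L0ppP => j; rewrite coordK lt_min ltr01 divr_gt0// ltr_wpDl.
have f0 : L0pp f by apply/L0ppP => j; rewrite coordK divr_gt0// ltr_wpDl.
exists ([set b : L0c P | L0_ball d (b - a : L0 P)],
        [set y : with_topology span_topologyP | span_ball f (y - x)]).
  split; first exact: nbhs_L0c.
  by apply/nbhs_spanP; exists f => // u ue /=; rewrite addrAC subrr add0r.
move=> [b y] /= [/L0_ballP bd /(span_ballP _ f0) yf].
have -> : (b : L0 P) *: y = (a : L0 P) *: x + ((b : L0 P) *: y - (a : L0 P) *: x).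
  by rewrite addrC subrK.
apply: eN; apply/(span_ballP _ e0); apply: for_large_imp yf => j.
have := bd j; rewrite !(coordD, coordN, coordM) [coord d j]coordK [coord f j]coordK.
move=> bj yj; apply: le_trans (scale_bound _ _ _ _ _ _ (ltW (h0 j)) bj yj) _.
exact: half_bound.
Qed.

(** * The topology is not induced by seminorms *)

(** The condition on x says that p x < 1 in every coordinate. *)
Lemma seminorm_open_ball (Ps : set ((L0 P)^o -> L0 P)) p :
  (forall q, Ps q -> L0_seminorm q) -> Ps p ->
  seminorm_topology Ps [set x | L0pp (1 - p x)].
Proof.
move=> Ps_semi Psp y /= py.
have [_ _ p_tri] := Ps_semi _ Psp.
pose e := half (1 - p y).
exists (seminorm_ball [set p] e).
  exists [set p], e; split => //; first by move=> _ ->.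
  exact: half_pp.
move=> _ [u /(_ p erefl)/le_coordP ue <-]; apply/L0ppP => j /=.
have /le_coordP/(_ j) := p_tri y u.
move/L0ppP/(_ j): py; move: (ue j).
by rewrite coordK !(coordD, coordN) coord1; lra.
Qed.

(** If the coordinate c = p(x)_j were nonzero, x cut off to {j} and divided by c
    would have finite support, hence lie in {p < 1}, although its seminorm is 1
    in coordinate j. *)
Lemma span_open_seminorm0 (p : (L0 P)^o -> L0 P) (x : (L0 P)^o) :
  L0_seminorm p -> span_topology P [set y | L0pp (1 - p y)] -> p x = 0.
Proof.
move=> [p_ge0 p_hom _] p_open.
have p0 : L0pp (1 - p 0).
  have -> : p 0 = 0.
    rewrite -[X in p X](scale0r (0 : (L0 P)^o)) p_hom.
    by apply: coord_inj => j; rewrite coordM coord_abs coord0 normr0 mul0r.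
  by apply/L0ppP => j; rewrite coordD coordN coord0 coord1 subr0.
have [_ [e e0 <-] Up] := p_open _ p0.
apply: coord_inj => j; rewrite coord0; apply: contrapT => /eqP pxj.
pose t : L0 P := of_coord (fun i => (i == j)%:R / coord (p x) j).
have : L0pp (1 - p (t *: x)).
  apply: Up; exists (t *: x); last by rewrite add0r.
  apply/(span_ballP _ e0); exists (val j) => i ji.
  rewrite coordM coordK (_ : (i == j) = false).
    by rewrite !mul0r normr0 ltW//; move: i {ji}; apply/L0ppP.
  by apply/eqP => ij; rewrite ij ltnn in ji.
move=> /L0ppP/(_ j); rewrite coordD coordN coord1 p_hom coordM coord_abs coordK.
rewrite eqxx mul1r ger0_norm ?mulVf ?subrr ?ltxx// invr_ge0.
by have /le_coordP/(_ j) := p_ge0 x; rewrite coord0.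
Qed.

(** The bound is a constant that depends on [x], and it may fail on finitely
    many coordinates: this makes the set stable under adding elements of
    [span_ball 1]. *)
Definition essentially_bounded x :=
  exists c, for_large (fun j => `|coord x j| <= c).

Lemma essentially_bounded_open : span_topology P essentially_bounded.
Proof.
have one0 : L0pp (1 : L0 P) by apply/L0ppP => j; rewrite coord1.
move=> y [c yc]; exists (span_ball 1); first by exists 1.
move=> _ [u /(span_ballP _ one0) u1 <-]; exists (c + 1).
apply: for_large_imp2 yc u1 => j yj; rewrite coord1 => uj.
by rewrite coordD (le_trans (ler_normD _ _))// lerD.
Qed.

Lemma not_essentially_bounded :
  ~ essentially_bounded (of_coord (fun j => (val j)%:R)).
Proof.
move=> [c [n h]].
pose k : posint := exist _ (maxn n (Num.bound `|c|)).+1 isT.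
have := h k; rewrite coordK /= ltnS leq_maxl => /(_ isT).
apply/negP; rewrite -ltNge ger0_norm// (le_lt_trans (ler_norm c))//.
rewrite (lt_le_trans (archi_boundP (normr_ge0 c)))// ler_nat.
by rewrite (leq_trans (leq_maxr n _)).
Qed.

Lemma span_topology_not_seminorm (Ps : set ((L0 P)^o -> L0 P)) :
  (forall p, Ps p -> L0_seminorm p) -> span_topology P <> seminorm_topology Ps.
Proof.
move=> Ps_semi spanE.
have p0 p x : Ps p -> p x = 0.
  move=> Psp; apply: span_open_seminorm0; first exact: Ps_semi.
  by rewrite spanE; exact: seminorm_open_ball.
have := essentially_bounded_open; rewrite spanE => /(_ 0)[].
  by exists 0; apply: for_large_all => j; rewrite coord0 normr0.
move=> _ [Q [e [_ QPs /L0ppP e0 ->]]] QE; apply: not_essentially_bounded.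
apply: QE; eexists; last exact: add0r.
move=> p /QPs/p0 ->; apply/le_coordP => j; by rewrite coord0 ltW.
Qed.

End Coordinates.

Theorem mainTheorem2 (R : realType) (P : probability posint R)
    (P_single : forall j : posint, P [set j] = ((2 ^- val j)%:E)%E) :
  [/\ forall eps : L0 P, L0pp eps ->
        [/\ L0_convex (span_ball eps), L0_absorbent (span_ball eps)
          & L0_balanced (span_ball eps)],
      exists span_top : is_topology (span_topology P),
        locally_L0_convex span_top /\
        nbhs_base (0 : with_topology span_top)
          [set span_ball eps | eps in L0pp]
    & ~ exists Ps : set ((L0 P)^o -> L0 P),
          (forall p, Ps p -> L0_seminorm p) /\
          span_topology P = seminorm_topology Ps].
Proof.
have shape (eps : L0 P) : L0pp eps ->
    [/\ L0_convex (span_ball eps : set (L0 P)^o),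
        L0_absorbent (span_ball eps : set (L0 P)^o)
      & L0_balanced (span_ball eps : set (L0 P)^o)].
  move=> eps0; split; [exact: span_ball_convex | exact: span_ball_absorbent |
    exact: span_ball_balanced].
have base : nbhs_base (0 : with_topology (span_topologyP P_single))
    [set span_ball eps | eps in L0pp].
  split=> [_ [e e0 <-]|N /nbhs_spanP[e e0 eN]].
    by apply/nbhs_spanP; exists e => // u; rewrite add0r.
  exists (span_ball e); first by exists e.
  by move=> u /eN; rewrite add0r.
split=> //.
- exists (span_topologyP P_single); split => //; split.
    exact: span_topology_module.
  by exists [set span_ball eps | eps in L0pp]; split => // _ [e /shape ? <-].
- by move=> [Ps [/(span_topology_not_seminorm P_single)]].
Qed.
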